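(* Let $A\in\mathbf{C}^{n\times n}$ and consider the nonlinear matrix equation $$X+A^{*}\overline{X}^{-1}A=I_{n}.$$ This equation has a positive definite solution provided $\left\Vert A\right\Vert\leq\frac{1}{2}$. Moreover, if $A$ is con-normal, then the equation has a positive definite solution if and only if $\left\Vert A\right\Vert\leq\frac{1}{2}$. In this case, the maximal positive definite solution is given by $$X_{+}=\frac{1}{2}\left(I_{n}+\left(I_{n}-4A^{*}A\right)^{\frac{1}{2}}\right).$$ If $A$ is further assumed to be nonsingular, then the minimal positive definite solution can be expressed as $$X_{-}=\frac{1}{2}\left(I_{n}-\left(I_{n}-4A^{*}A\right)^{\frac{1}{2}}\right).$$
   Context: Notation: $\overline{M}$, $M^{*}$ denote the entrywise conjugate and the conjugate transpose of a complex matrix $M$; $\Vert M\Vert$ is the $2$-norm (spectral norm); $M^{1/2}$ is the positive semidefinite square root of a positive semidefinite matrix. A matrix $A\in\mathbf{C}^{n\times n}$ is con-normal if $A^{*}A=\overline{AA^{*}}$. A maximal (respectively minimal) positive definite solution is a positive definite solution $X_{+}$ (respectively $X_{-}$) such that every positive definite solution $X$ satisfies $X\le X_{+}$ (respectively $X_{-}\le X$) in the Loewner order. *)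

(* Defs.v *)
From mathcomp Require Import all_boot all_order all_algebra.
From mathcomp Require Import boolp classical_sets reals.
From mathcomp Require Import complex.

Set Implicit Arguments.
Unset Strict Implicit.
Unset Printing Implicit Defensive.

Import Order.TTheory GRing.Theory Num.Theory.
Import Num.Def.

Local Open Scope ring_scope.
Local Open Scope complex_scope.
Local Open Scope classical_set_scope.
Local Open Scope sesquilinear_scope.

Definition quadform (R : realType) (n : nat) (M : 'M[R[i]]_n) (x : 'cV[R[i]]_n)
  : R[i] := (x ^t* *m M *m x) 0 0.

(* In the partial order of R[i], [0 <= z] and [0 < z] include the assertion that
   z is real. *)
Definition psdmx (R : realType) (n : nat) (M : 'M[R[i]]_n) : Prop :=
  M \is hermsymmx /\ forall x : 'cV[R[i]]_n, 0 <= quadform M x.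

Definition pdmx (R : realType) (n : nat) (M : 'M[R[i]]_n) : Prop :=
  M \is hermsymmx /\ forall x : 'cV[R[i]]_n, x != 0 -> 0 < quadform M x.

Definition loewner_le (R : realType) (n : nat) (M N : 'M[R[i]]_n) : Prop :=
  psdmx (N - M).

(* Only meaningful when M is positive semidefinite, in which case such an S
   exists and is unique; the default value 0 is irrelevant. *)
Definition psd_sqrtmx (R : realType) (n : nat) (M : 'M[R[i]]_n) : 'M[R[i]]_n :=
  xget 0 [set S : 'M[R[i]]_n | psdmx S /\ S *m S = M].

Definition vnorm2 (R : realType) (n : nat) (x : 'cV[R[i]]_n) : R :=
  Num.sqrt (\sum_(k < n) Normc.normc (x k 0) ^+ 2).

(* For n = 0 this is the supremum of the empty set, which is 0. *)
Definition spectral_norm (R : realType) (n : nat) (M : 'M[R[i]]_n) : R :=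
  sup [set vnorm2 (M *m x) | x in [set x : 'cV[R[i]]_n | vnorm2 x = 1]].

Definition connormalmx (R : realType) (n : nat) (A : 'M[R[i]]_n) : Prop :=
  A ^t* *m A = (A *m A ^t*) ^ conjC.

Definition pd_solution (R : realType) (n : nat) (A X : 'M[R[i]]_n) : Prop :=
  pdmx X /\ X + A ^t* *m invmx (X ^ conjC)%sesqui *m A = 1%:M.

Definition maximal_pd_solution (R : realType) (n : nat) (A X : 'M[R[i]]_n)
  : Prop :=
  pd_solution A X /\
  forall Y : 'M[R[i]]_n, pd_solution A Y -> loewner_le Y X.

Definition minimal_pd_solution (R : realType) (n : nat) (A X : 'M[R[i]]_n)
  : Prop :=
  pd_solution A X /\
  forall Y : 'M[R[i]]_n, pd_solution A Y -> loewner_le X Y.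

(* Main.v *)
Require Import Defs.
From mathcomp Require Import all_boot all_order all_algebra.
From mathcomp Require Import boolp classical_sets reals.
From mathcomp Require Import topology normedtype sequences.
From mathcomp Require Import complex.
From mathcomp Require Import ring lra.

(** Write [F X = 1 - A^* (conj X)^-1 A], so that the positive definite solutions
    are the positive definite fixed points of [F].  Conjugation preserves the
    Loewner order and inversion reverses it on positive definite matrices
    ([loewner_inv]), hence [F] is monotone.  Call a positive definite [L] with
    [L <= F L] a subsolution; every solution is one, and every subsolution is
    at most [F L <= 1].  If there is a subsolution, the iterates of [F] from
    [1] decrease and stay above all subsolutions, so they converge to a
    solution that lies above every subsolution, in particular above every
    solution ([iterate_cvg]).

    When [|A| <= 1/2], that is [0 <= 1 - 4 A^* A], the matrix [1/2] is a
    subsolution ([half_subsolution]), which gives the first claim.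

    Let [A] be con-normal.  Then [A X = (conj X) A] is inherited by [F X]
    ([connormal_eqmap]).  It holds for [X = 1], hence for all iterates and for
    their limit [X].  The equation at [X] thereby collapses to
    [X^2 + A^* A = X], that is [(2 X - 1)^2 = 1 - 4 A^* A]
    ([connormal_solution]).  So as soon as some solution exists,
    [1 - 4 A^* A] is the square of a hermitian matrix, hence positive
    semidefinite, which is [|A| <= 1/2].  Conversely, if [|A| <= 1/2] then
    [X >= 1/2], so [2 X - 1] is positive semidefinite and must be the square
    root of [1 - 4 A^* A] ([psd_sqrt_unique], [connormal_maximal]); no
    functional calculus enters.

    For invertible [A], the order-reversing map [Y |-> 1 - Y] carries solutions
    for [A] to solutions for [A^T] ([solution_trmx]).  Since [A^T] is con-normal
    with the same Gram matrix as [A], the maximal solution for [A^T] is sent to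
    the minimal solution for [A].

    Limits in [R[i]] are taken on real and imaginary parts, so that monotone
    convergence is that of real sequences, applied to the values of the
    quadratic forms; polarization passes from these to the entries. *)

Set Implicit Arguments.
Unset Strict Implicit.
Unset Printing Implicit Defensive.

Import Order.TTheory GRing.Theory Num.Theory.
Import Num.Def.
Import numFieldNormedType.Exports.

Local Open Scope ring_scope.
Local Open Scope sesquilinear_scope.

Local Notation cmx := (map_mx conjC).

(** * Conjugate transposes *)

Section ConjugateTranspose.
Variable C : numClosedFieldType.

Lemma adjmxM m n p (A : 'M[C]_(m, n)) (B : 'M[C]_(n, p)) :
  (A *m B) ^t* = B ^t* *m A ^t*.
Proof. by rewrite trmx_mul map_mxM. Qed.

Lemma adjmxD m n (A B : 'M[C]_(m, n)) : (A + B) ^t* = A ^t* + B ^t*.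
Proof. by rewrite linearD /= map_mxD. Qed.

Lemma adjmxB m n (A B : 'M[C]_(m, n)) : (A - B) ^t* = A ^t* - B ^t*.
Proof. by rewrite linearB /= map_mxB. Qed.

Lemma adjmx1 n : (1%:M : 'M[C]_n) ^t* = 1%:M.
Proof. by rewrite trmx1 map_mx1. Qed.

Lemma adjmxZ m n (c : C) (A : 'M[C]_(m, n)) : (c *: A) ^t* = c^* *: A ^t*.
Proof. by rewrite linearZ /= map_mxZ. Qed.

Lemma adjmx_inv n (A : 'M[C]_n) : (invmx A) ^t* = invmx (A ^t*).
Proof. by rewrite trmx_inv map_invmx. Qed.

Lemma adjmx_conj m n (A : 'M[C]_(m, n)) : (cmx A) ^t* = cmx (A ^t*).
Proof. by rewrite map_trmx. Qed.

Lemma mxconjM m n p (A : 'M[C]_(m, n)) (B : 'M[C]_(n, p)) :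
  cmx (A *m B) = cmx A *m cmx B.
Proof. exact: map_mxM. Qed.

Lemma mxconjB m n (A B : 'M[C]_(m, n)) : cmx (A - B) = cmx A - cmx B.
Proof. exact: map_mxB. Qed.

Lemma mxconj1 n : cmx (1%:M : 'M[C]_n) = 1%:M.
Proof. exact: map_mx1. Qed.

Lemma mxconjV n (A : 'M[C]_n) : cmx (invmx A) = invmx (cmx A).
Proof. by rewrite map_invmx. Qed.

Lemma hermP n (M : 'M[C]_n) : M \is hermsymmx <-> M ^t* = M.
Proof.
split=> [/is_hermitianmxP|e]; first by rewrite expr0 scale1r => <-.
by apply/is_hermitianmxP; rewrite expr0 scale1r.
Qed.

(** The quadratic polynomial in [t] behind the Cauchy-Schwarz type argument of
    [psd_quadform_eq0]; the cross terms are grouped so that each contains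
    [M *m x]. *)
Lemma quadform_line n (M : 'M[C]_n) (x y : 'cV[C]_n) (t : C) :
  M ^t* = M -> t^* = t ->
  ((x + t *: y) ^t* *m M *m (x + t *: y)) 0 0 =
  (x ^t* *m M *m x) 0 0 +
    t * ((y ^t* *m (M *m x)) 0 0 + ((M *m x) ^t* *m y) 0 0 +
         t * (y ^t* *m M *m y) 0 0).
Proof.
move=> hM tr; rewrite adjmxD adjmxZ tr !mulmxDl !mulmxDr adjmxM hM.
rewrite -!scalemxAl -!scalemxAr !mulmxA.
move: (x ^t* *m M *m x) (x ^t* *m M *m y) (y ^t* *m M *m x) (y ^t* *m M *m y).
by move=> p q r s; rewrite !mxE; ring.
Qed.

End ConjugateTranspose.

(** * Positive matrices and the Loewner order *)

Section Positivity.
Variables (R : realType) (n : nat).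
Local Notation C := R[i].
Implicit Types (A B M N X Y : 'M[C]_n) (x y : 'cV[C]_n).

Lemma quadformD M N x : quadform (M + N) x = quadform M x + quadform N x.
Proof. by rewrite /quadform mulmxDr mulmxDl mxE. Qed.

Lemma quadformN M x : quadform (- M) x = - quadform M x.
Proof. by rewrite /quadform mulmxN mulNmx mxE. Qed.

Lemma quadformZ c M x : quadform (c *: M) x = c * quadform M x.
Proof. by rewrite /quadform -scalemxAr -scalemxAl mxE. Qed.

Lemma quadform_congr A M x : quadform (A ^t* *m M *m A) x = quadform M (A *m x).
Proof. by rewrite /quadform adjmxM !mulmxA. Qed.

Lemma quadform_conj M x : quadform (cmx M) x = (quadform M (cmx x))^*.
Proof.
rewrite /quadform -(map_mxCK x) adjmx_conj -!map_mxM mxE map_mxCK.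
by rewrite adjmx_conj.
Qed.

Lemma quadform1E x : quadform 1%:M x = \sum_i `|x i 0| ^+ 2.
Proof.
rewrite /quadform mulmx1 mxE; apply: eq_bigr => i _.
by rewrite !mxE mulrC -normCK.
Qed.

Lemma pd1 : pdmx (1%:M : 'M[C]_n).
Proof.
split; first by apply/hermP; rewrite adjmx1.
move=> x x0; rewrite quadform1E lt_neqAle sumr_ge0 ?andbT => [|i _].
  apply: contra x0 => /eqP/esym/psumr_eq0P H; apply/eqP/matrixP => i j.
  rewrite ord1 mxE; apply/eqP; rewrite -normr_eq0 -sqrf_eq0 H //.
  by move=> k _; rewrite exprn_ge0.
by rewrite exprn_ge0.
Qed.

Lemma pd_psd M : pdmx M -> psdmx M.
Proof.
case=> hM pM; split=> // x; have [->|/pM/ltW//] := eqVneq x 0.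
by rewrite /quadform mulmx0 mxE.
Qed.

Lemma psd0 : psdmx (0 : 'M[C]_n).
Proof.
split; first by apply/hermP; rewrite trmx0 map_mx0.
by move=> x; rewrite /quadform mulmx0 mul0mx mxE.
Qed.

Lemma psdD M N : psdmx M -> psdmx N -> psdmx (M + N).
Proof.
case=> /hermP hM pM [/hermP hN pN]; split; first by apply/hermP; rewrite adjmxD hM hN.
by move=> x; rewrite quadformD addr_ge0.
Qed.

Lemma psdZ c M : 0 <= c -> psdmx M -> psdmx (c *: M).
Proof.
move=> c0 [/hermP hM pM]; split.
  by apply/hermP; rewrite adjmxZ hM; congr (_ *: _); apply: geC0_conj.
by move=> x; rewrite quadformZ mulr_ge0.
Qed.

Lemma pdZ c M : 0 < c -> pdmx M -> pdmx (c *: M).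
Proof.
move=> c0 pM; split; first by case: (psdZ (ltW c0) (pd_psd pM)).
by case: pM => _ pM x /pM; rewrite quadformZ => ?; rewrite mulr_gt0.
Qed.

Lemma psd_congr A M : psdmx M -> psdmx (A ^t* *m M *m A).
Proof.
case=> /hermP hM pM; split; first by apply/hermP; rewrite !adjmxM trmxCK hM mulmxA.
by move=> x; rewrite quadform_congr.
Qed.

Lemma psd_gram A : psdmx (A ^t* *m A).
Proof. by rewrite -[A ^t*]mulmx1; apply/psd_congr/pd_psd/pd1. Qed.

Lemma pd_congr A M : A \in unitmx -> pdmx M -> pdmx (A ^t* *m M *m A).
Proof.
move=> uA pM; split; first by case: (psd_congr A (pd_psd pM)).
case: pM => _ pM x x0; rewrite quadform_congr; apply: pM.
by apply: contra x0 => /eqP e; rewrite -(mulKmx uA x) e mulmx0.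
Qed.

Lemma psd_conj M : psdmx M -> psdmx (cmx M).
Proof.
case=> /hermP hM pM; split; first by apply/hermP; rewrite adjmx_conj hM.
by move=> x; rewrite quadform_conj conj_ge0.
Qed.

Lemma pd_conj M : pdmx M -> pdmx (cmx M).
Proof.
move=> pM; split; first by case: (psd_conj (pd_psd pM)).
case: pM => _ pM x x0; rewrite quadform_conj.
have /pM : cmx x != 0.
  by apply: contra x0 => /eqP e; rewrite -[x]map_mxCK e map_mx0.
by rewrite !lt_def conjc_eq0 conj_ge0.
Qed.

Lemma pd_unit M : pdmx M -> M \in unitmx.
Proof.
case=> /hermP hM pM; rewrite -row_free_unit -kermx_eq0; apply/eqP/row_matrixP => i.
rewrite row0; set v := row i _.
have vM : v *m M = 0 by rewrite -row_mul mulmx_ker row0.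
apply/eqP/negPn/negP => v0.
have /pM : v ^t* != 0 by apply: contra v0 => /eqP e; rewrite -[v]trmxCK e trmx0 map_mx0.
by rewrite /quadform trmxCK vM mul0mx mxE ltxx.
Qed.

(** [M^-1] is congruent to [M], because [M^-1 = (M^-1)^* M M^-1]. *)
Lemma pd_inv M : pdmx M -> pdmx (invmx M).
Proof.
move=> pM; have uM := pd_unit pM.
have -> : invmx M = (invmx M) ^t* *m M *m invmx M.
  by rewrite adjmx_inv; case: pM => /hermP -> _; rewrite mulVmx ?mul1mx.
by apply: pd_congr; rewrite ?unitmx_inv.
Qed.

Lemma pdDpsd M N : pdmx M -> psdmx N -> pdmx (M + N).
Proof.
move=> pM pN; split; first by case: (psdD (pd_psd pM) pN).
by case: pM pN => _ pM [_ pN] x /pM ?; rewrite quadformD ltr_wpDr.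
Qed.

Lemma loewner_pd M N : pdmx M -> loewner_le M N -> pdmx N.
Proof. by move=> pM /(pdDpsd pM); rewrite addrC subrK. Qed.

Lemma loewner_refl M : loewner_le M M.
Proof. by rewrite /loewner_le subrr; apply: psd0. Qed.

Lemma loewner_trans N M X : loewner_le M N -> loewner_le N X -> loewner_le M X.
Proof. by move=> h1 /psdD/(_ h1); rewrite addrA subrK. Qed.

Lemma loewner_congr A M N :
  loewner_le M N -> loewner_le (A ^t* *m M *m A) (A ^t* *m N *m A).
Proof. by move/(psd_congr A); rewrite mulmxBr mulmxBl. Qed.

Lemma loewner_conj M N : loewner_le M N -> loewner_le (cmx M) (cmx N).
Proof. by move/psd_conj; rewrite map_mxB. Qed.

(** The difference of the inverses is a sum of two congruences of positive
    semidefinite matrices: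
    [M^-1 - N^-1 = (N^-1 - M^-1) M (N^-1 - M^-1) + N^-1 (N - M) N^-1]. *)
Lemma loewner_inv M N :
  pdmx M -> loewner_le M N -> loewner_le (invmx N) (invmx M).
Proof.
move=> pM leMN; have pN := loewner_pd pM leMN.
have [uM uN] := (pd_unit pM, pd_unit pN).
have [/hermP hM _] := pd_inv pM; have [/hermP hN _] := pd_inv pN.
have := psdD (psd_congr (invmx N - invmx M) (pd_psd pM)) (psd_congr (invmx N) leMN).
congr (psdmx _); rewrite adjmxB hM hN !mulmxBl !mulmxBr !mulmxBl.
rewrite mulVmx // mul1mx !(mulmxK uM) mulVmx // mul1mx mul1mx.
move: (_ *m M *m _) => T; apply/matrixP => i j; rewrite !mxE; ring.
Qed.

(** With [y = M x], the form on the line [x + t y] is [t (2 a + t b)], where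
    [a = |y|^2] and [b] is the form at [y].  It has to stay nonnegative for small
    negative [t], which forces [a = 0]. *)
Lemma psd_quadform_eq0 M x : psdmx M -> quadform M x = 0 -> M *m x = 0.
Proof.
case=> /hermP hM pM q0; set y := M *m x.
have a0 : 0 <= quadform 1%:M y by case: (pd_psd pd1).
set a := quadform 1%:M y in a0; set b := quadform M y.
have b0 : 0 <= b by exact: pM.
suff a_eq0 : a = 0.
  by apply/eqP/negPn/negP => /(proj2 pd1); rewrite -/a a_eq0 ltxx.
have qE t : t^* = t -> quadform M (x + t *: y) = t * (a + a + t * b).
  move=> tr; rewrite /quadform quadform_line //= -/(quadform M x) q0 add0r.
  by rewrite /a /quadform mulmx1.
have b1 : 0 < b + 1 by rewrite ltr_wpDl.
(* Adding 1 to b keeps the denominator nonzero; t = - a / (b + 1) then makes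
   the value negative unless a = 0. *)
have : 0 <= quadform M (x + (- a / (b + 1)) *: y) by exact: pM.
rewrite qE; last by rewrite conj_Creal // rpredM ?rpredN ?rpredV ?ger0_real // ltW.
have -> : - a / (b + 1) * (a + a + - a / (b + 1) * b) =
    - (a ^+ 2 * (b + 2) / (b + 1) ^+ 2) by field; rewrite gt_eqF.
rewrite oppr_ge0 pmulr_lle0 ?invr_gt0 ?exprn_gt0 //.
rewrite pmulr_lle0 ?ltr_wpDl // => a2.
by apply/eqP; rewrite -sqrf_eq0 eq_le a2 exprn_ge0.
Qed.

End Positivity.

(** * Uniqueness of the positive square root *)

Section SquareRoot.
Variables (R : realType) (n : nat).
Local Notation C := R[i].
Implicit Types (M S T : 'M[C]_n).

Lemma quadform_delta M i : quadform M (delta_mx i 0) = M i i.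
Proof. by rewrite /quadform trmx_delta map_delta_mx -rowE -colE !mxE. Qed.

Lemma mx_delta_eq0 (A : 'M[C]_n) :
  (forall i, A *m (delta_mx i 0 : 'cV_n) = 0) -> A = 0.
Proof.
move=> A0; apply/matrixP => i j; have /matrixP/(_ i 0) := A0 j.
by rewrite -colE !mxE.
Qed.

Lemma gram_eq0 (A : 'M[C]_n) : A ^t* *m A = 0 -> A = 0.
Proof.
move=> A0; apply: mx_delta_eq0 => i; apply/eqP/negPn/negP => /(proj2 (pd1 _ _)).
by rewrite -quadform_congr mulmx1 A0 /quadform mulmx0 mul0mx mxE ltxx.
Qed.

(** With [D = S - T], equality of the squares says [D S = - T D].  Hence
    [D S D] and [D T D], both positive semidefinite, have opposite traces, so
    their diagonals vanish.  The diagonal entries are the forms of [S] and [T] at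
    the columns of [D], so [S D = T D = 0], whence [D^* D = D^2 = 0]. *)
Lemma psd_sqrt_unique S T :
  psdmx S -> psdmx T -> S *m S = T *m T -> S = T.
Proof.
move=> pS pT eST; apply/eqP; rewrite -subr_eq0; apply/eqP; set D := S - T.
have hD : D ^t* = D by rewrite /D adjmxB (hermP _).1 ?(hermP _).1 //; [case: pT|case: pS].
have DS : D *m S = - (T *m D).
  by rewrite /D mulmxBl mulmxBr opprB eST.
have pDS : psdmx (D *m S *m D) by rewrite -{1}hD; apply: psd_congr.
have pDT : psdmx (D *m T *m D) by rewrite -{1}hD; apply: psd_congr.
have tr0 : \sum_i (quadform (D *m S *m D) (delta_mx i 0) +
                   quadform (D *m T *m D) (delta_mx i 0)) = 0.
  rewrite big_split /=; under eq_bigr do rewrite quadform_delta.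
  under [X in _ + X]eq_bigr do rewrite quadform_delta.
  rewrite -!/(\tr _) DS mulNmx raddfN /= mxtrace_mulC mulmxA addNr //.
have q0 i : quadform (D *m S *m D) (delta_mx i 0) = 0 /\
            quadform (D *m T *m D) (delta_mx i 0) = 0.
  move/psumr_eq0P: tr0 => /(_ _ i isT) /eqP.
  rewrite paddr_eq0; [|exact: (proj2 pDS)|exact: (proj2 pDT)].
  case/(_ _)/andP => [j _|/eqP -> /eqP -> //].
  by rewrite addr_ge0 //; [exact: (proj2 pDS)|exact: (proj2 pDT)].
have SD : S *m D = 0.
  apply: mx_delta_eq0 => i; rewrite -mulmxA; apply: psd_quadform_eq0 => //.
  by rewrite -quadform_congr hD (q0 i).1.
have TD : T *m D = 0.
  apply: mx_delta_eq0 => i; rewrite -mulmxA; apply: psd_quadform_eq0 => //.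
  by rewrite -quadform_congr hD (q0 i).2.
by apply: gram_eq0; rewrite hD {1}/D mulmxBl SD TD subrr.
Qed.

Lemma psd_sqrtmxE S M : psdmx S -> S *m S = M -> psd_sqrtmx M = S.
Proof.
move=> pS SM; apply: xget_unique => // T [pT TM].
by apply: psd_sqrt_unique; rewrite ?TM.
Qed.

End SquareRoot.

(** * The spectral norm as a Loewner bound *)

Section SpectralNorm.
Variables (R : realType) (n : nat).
Local Notation C := R[i].
Implicit Types (A : 'M[C]_n) (x : 'cV[C]_n).

Lemma normc_ge0 (z : C) : 0 <= Normc.normc z.
Proof. by case: z => a b; apply: sqrtr_ge0. Qed.

Lemma vnorm2_ge0 x : 0 <= vnorm2 x.
Proof. exact: sqrtr_ge0. Qed.

Lemma sqr_vnorm2 x : (vnorm2 x ^+ 2)%:C%C = quadform 1%:M x.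
Proof.
rewrite quadform1E /vnorm2 sqr_sqrtr; last by apply: sumr_ge0 => i _; apply: sqr_ge0.
by rewrite rmorph_sum; apply: eq_bigr => i _; rewrite rmorphXn.
Qed.

Lemma vnorm2_eq0 x : (vnorm2 x == 0) = (x == 0).
Proof.
rewrite -sqrf_eq0 -(inj_eq (@complexI R)) sqr_vnorm2.
have [->|/(proj2 (pd1 _ _))/gt_eqF //] := eqVneq x 0.
by rewrite /quadform mulmx0 mxE eqxx.
Qed.

Lemma vnorm2Z (c : R) x : 0 <= c -> vnorm2 (c%:C%C *: x) = c * vnorm2 x.
Proof.
move=> c0; apply/eqP; rewrite -(@eqrXn2 _ 2) ?mulr_ge0 ?vnorm2_ge0 //.
rewrite -(inj_eq (@complexI R)) exprMn (rmorphM _ (c ^+ 2)) /=.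
rewrite !sqr_vnorm2 !quadform1E.
rewrite mulr_sumr; apply/eqP/eq_bigr => i _.
by rewrite mxE normrM exprMn rmorphXn /= ger0_norm // ler0c.
Qed.

(** Without an upper bound the supremum defining the norm would be a default
    value; the estimate uses that each entry of a unit vector has modulus at
    most 1. *)
Lemma vnorm2_sphere_bounded A :
  exists b : R, forall x, vnorm2 x = 1 -> vnorm2 (A *m x) <= b.
Proof.
exists (Num.sqrt (\sum_i (\sum_j Normc.normc (A i j)) ^+ 2)) => x x1.
have xj j : Normc.normc (x j 0) <= 1.
  rewrite -(@ler_pXn2r _ 2) ?nnegrE ?normc_ge0 // expr1n.
  rewrite -[leRHS](expr1n _ 2) -x1 sqr_sqrtr; last first.
    by apply: sumr_ge0 => k _; apply: sqr_ge0.
  by rewrite (bigD1 j) //= lerDl; apply: sumr_ge0 => k _; apply: sqr_ge0.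
apply/ler_wsqrtr/ler_sum => i _.
rewrite ler_pXn2r ?nnegrE ?normc_ge0 //; last first.
  by apply: sumr_ge0 => j _; apply: normc_ge0.
rewrite -lecR rmorph_sum mxE.
change (`|\sum_j A i j * x j 0| <= \sum_j `|A i j|).
apply: le_trans (ler_norm_sum _ _ _) _.
apply: ler_sum => j _; rewrite normrM ler_piMr //.
by have := xj j; rewrite -lecR.
Qed.

(** By homogeneity the bound on the unit sphere extends to all vectors.  In
    dimension 0 the sphere is empty and the supremum is 0, which is why [c] is
    taken nonnegative. *)
Lemma spectral_norm_le_bound (c : R) A : 0 <= c ->
  spectral_norm A <= c <-> forall x, vnorm2 (A *m x) <= c * vnorm2 x.
Proof.
move=> c0; split=> [leAc x|Ac].
  have [->|x0] := eqVneq x 0.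
    by rewrite mulmx0 (eqP (_ : vnorm2 0 == 0)) ?mulr0 // vnorm2_eq0.
  have nx0 : 0 < vnorm2 x by rewrite lt_neqAle vnorm2_ge0 eq_sym vnorm2_eq0 x0.
  set y := ((vnorm2 x)^-1)%:C%C *: x.
  have y1 : vnorm2 y = 1 by rewrite vnorm2Z ?invr_ge0 ?vnorm2_ge0 // mulVf ?gt_eqF.
  have [b Ab] := vnorm2_sphere_bounded A.
  have : vnorm2 (A *m y) <= c.
    apply: le_trans leAc; apply: ub_le_sup; last by exists y.
    by exists b => _ [z z1 <-]; apply: Ab.
  by rewrite -scalemxAr vnorm2Z ?invr_ge0 ?vnorm2_ge0 // ler_pdivrMl // mulrC.
rewrite /spectral_norm; set S := (X in sup X).
have ubc : ubound S c.
  by move=> _ [x x1 <-]; rewrite (le_trans (Ac x)) // x1 mulr1.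
have [->|/set0P ne] := eqVneq S set0; first by rewrite sup0.
exact: ge_sup.
Qed.

Lemma spectral_norm_le_half A :
  spectral_norm A <= 1 / 2 <-> psdmx (1%:M - 4 *: (A ^t* *m A)).
Proof.
have herm : 1%:M - 4 *: (A ^t* *m A) \is hermsymmx.
  apply/hermP; rewrite adjmxB adjmx1 adjmxZ adjmxM trmxCK.
  by rewrite conj_Creal ?realn.
have qE x : quadform (1%:M - 4 *: (A ^t* *m A)) x =
   (vnorm2 x ^+ 2 - 4 * vnorm2 (A *m x) ^+ 2)%:C%C.
  rewrite quadformD quadformN quadformZ -[A ^t*]mulmx1 quadform_congr -!sqr_vnorm2.
  by rewrite rmorphB (rmorphM _ 4) /= rmorph_nat.
have half0 : (0 : R) <= 1 / 2 by rewrite divr_ge0.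
have half x : (vnorm2 (A *m x) <= 1 / 2 * vnorm2 x) =
    (0 <= quadform (1%:M - 4 *: (A ^t* *m A)) x).
  rewrite qE ler0c subr_ge0 -(@ler_pXn2r _ 2 _ (vnorm2 (A *m x)));
    rewrite ?nnegrE ?vnorm2_ge0 ?(mulr_ge0 half0) ?vnorm2_ge0 //.
  rewrite exprMn; move: (vnorm2 x ^+ 2) (vnorm2 _ ^+ 2) => a b.
  by apply/idP/idP => ?; lra.
have bP := spectral_norm_le_bound A half0.
split=> [/bP Ac|[_ pA]]; first by split=> // x; rewrite -half.
by apply/bP => x; rewrite half.
Qed.

End SpectralNorm.

(** * Limits of complex sequences *)

Section ComplexLimits.
Variable R : realType.
Local Notation C := R[i].
Implicit Types (u v : nat -> C) (l m : C).
Local Open Scope classical_set_scope.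

(** Convergence of real and imaginary parts, so that order completeness and the
    limit theorems for real sequences apply directly. *)
Definition ccvg u l :=
  (fun k => complex.Re (u k)) @ \oo --> complex.Re l /\
  (fun k => complex.Im (u k)) @ \oo --> complex.Im l.

Lemma ccvg_cst l : ccvg (fun=> l) l.
Proof. by split; apply: cvg_cst. Qed.

Lemma ccvg_unique u l m : ccvg u l -> ccvg u m -> l = m.
Proof.
case=> lr li [mr mi]; apply/eqP; rewrite eq_complex.
by rewrite (cvg_unique _ lr mr) // (cvg_unique _ li mi) // !eqxx.
Qed.

Lemma ccvg_ext u v l : u =1 v -> ccvg u l -> ccvg v l.
Proof. by move=> /funext ->. Qed.

Lemma ccvgS u l : ccvg u l -> ccvg (fun k => u k.+1) l.
Proof.
case=> lr li; split.
  by rewrite (cvg_shiftS (fun k => complex.Re (u k))).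
by rewrite (cvg_shiftS (fun k => complex.Im (u k))).
Qed.

Lemma ccvgD u v l m : ccvg u l -> ccvg v m -> ccvg (fun k => u k + v k) (l + m).
Proof.
case=> lr li [mr mi]; rewrite /ccvg !raddfD; split.
  by rewrite (_ : (fun k => _) = (fun k => complex.Re (u k) + complex.Re (v k)));
    [exact: cvgD|apply/funext => k; rewrite raddfD].
by rewrite (_ : (fun k => _) = (fun k => complex.Im (u k) + complex.Im (v k)));
    [exact: cvgD|apply/funext => k; rewrite raddfD].
Qed.

Lemma ccvgM u v l m : ccvg u l -> ccvg v m -> ccvg (fun k => u k * v k) (l * m).
Proof.
have ReM (x y : C) : complex.Re (x * y) =
   complex.Re x * complex.Re y - complex.Im x * complex.Im y.
  by case: x y => [a b] [c d].
have ImM (x y : C) : complex.Im (x * y) =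
   complex.Re x * complex.Im y + complex.Im x * complex.Re y.
  by case: x y => [a b] [c d].
case=> lr li [mr mi]; rewrite /ccvg ReM ImM; split.
  by under eq_fun do rewrite ReM; apply: cvgB; apply: cvgM.
by under eq_fun do rewrite ImM; apply: cvgD; apply: cvgM.
Qed.

Lemma ccvgZ c u l : ccvg u l -> ccvg (fun k => c * u k) (c * l).
Proof. exact/ccvgM/ccvg_cst. Qed.

Lemma ccvgN u l : ccvg u l -> ccvg (fun k => - u k) (- l).
Proof.
move/(ccvgZ (-1)); rewrite mulN1r; apply: ccvg_ext => k; exact: mulN1r.
Qed.

Lemma ccvg_conj u l : ccvg u l -> ccvg (fun k => conjC (u k)) (conjC l).
Proof.
have ReJ (x : C) : complex.Re (conjC x) = complex.Re x by case: x.
have ImJ (x : C) : complex.Im (conjC x) = - complex.Im x by case: x.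
case=> lr li; rewrite /ccvg ReJ ImJ; split.
  by under eq_fun do rewrite ReJ.
by under eq_fun do rewrite ImJ; apply: cvgN.
Qed.

Lemma ccvg_sum (I : Type) (r : seq I) (u_ : I -> nat -> C) (l_ : I -> C) :
  (forall i, ccvg (u_ i) (l_ i)) ->
  ccvg (fun k => \sum_(i <- r) u_ i k) (\sum_(i <- r) l_ i).
Proof.
move=> ul; elim: r => [|i r IHr].
  by rewrite big_nil; apply: ccvg_ext (ccvg_cst 0) => k; rewrite big_nil.
rewrite big_cons; apply: ccvg_ext (ccvgD (ul i) IHr) => k.
by rewrite big_cons.
Qed.

Lemma ccvg_ge0 u l : (forall k, 0 <= u k) -> ccvg u l -> 0 <= l.
Proof.
move=> u0 [lr li]; rewrite lecE /=; apply/andP; split.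
  have iu : (fun k => complex.Im (u k)) = fun=> 0.
    by apply/funext => k; have := u0 k; rewrite lecE => /andP[/eqP].
  by apply/eqP; rewrite iu in li; apply: (cvg_unique _ li (cvg_cst _)).
rewrite -(cvg_lim _ lr) //; apply: limr_ge; first by apply/cvg_ex; exists (complex.Re l).
by apply: nearW => k; have := u0 k; rewrite lecE => /andP[].
Qed.

(** Comparable complex numbers have equal imaginary parts, so the imaginary parts
    are constant and the real parts form a bounded monotone real sequence. *)
Lemma ccvg_nonincreasing u b :
  (forall k, u k.+1 <= u k) -> (forall k, b <= u k) -> exists l, ccvg u l.
Proof.
move=> du bu.
have nr : nonincreasing_seq (fun k => complex.Re (u k)).
  by apply/nonincreasing_seqP => k; have := du k; rewrite lecE => /andP[].
have br : has_lbound (range (fun k => complex.Re (u k))).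
  by exists (complex.Re b) => _ [k _ <-]; have := bu k; rewrite lecE => /andP[].
have ni k : complex.Im (u k) = complex.Im b.
  by have := bu k; rewrite lecE => /andP[/eqP].
have cr := nonincreasing_cvgn nr br.
exists ((inf (range (fun k => complex.Re (u k)))) +i* complex.Im b)%C; split=> //=.
by under eq_fun do rewrite ni; apply: cvg_cst.
Qed.

End ComplexLimits.

(** Recovers every matrix entry from three kinds of values of the quadratic form,
    which turns convergence of forms into convergence of entries. *)
Lemma polarization (C : numClosedFieldType) n (M : 'M[C]_n) (x y : 'cV[C]_n) :
  let q z := (z ^t* *m M *m z) 0 0 in
  (x ^t* *m M *m y) 0 0 =
  2^-1 * (q (x + y) - 'i * q (x + 'i *: y) - (1 - 'i) * (q x + q y)).
Proof.
rewrite /= !adjmxD adjmxZ conjCi !mulmxDl !mulmxDr -!scalemxAl -!scalemxAr.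
move: (x ^t* *m M *m x) (x ^t* *m M *m y) (y ^t* *m M *m x) (y ^t* *m M *m y).
move=> p q r s; rewrite !mxE.
by field: (sqrCi C).
Qed.

(** * Monotone convergence of matrices *)

Section MatrixLimits.
Variable R : realType.
Local Notation C := R[i].

Definition mxcvg m n (M_ : nat -> 'M[C]_(m, n)) (M : 'M[C]_(m, n)) :=
  forall i j, ccvg (fun k => M_ k i j) (M i j).

Lemma mxcvg_cst m n (M : 'M[C]_(m, n)) : mxcvg (fun=> M) M.
Proof. by move=> i j; apply: ccvg_cst. Qed.

Lemma mxcvg_ext m n (M_ N_ : nat -> 'M[C]_(m, n)) M :
  M_ =1 N_ -> mxcvg M_ M -> mxcvg N_ M.
Proof. by move=> /funext ->. Qed.

Lemma mxcvg_unique m n (M_ : nat -> 'M[C]_(m, n)) M N :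
  mxcvg M_ M -> mxcvg M_ N -> M = N.
Proof. by move=> cM cN; apply/matrixP => i j; apply: ccvg_unique (cM i j) (cN i j). Qed.

Lemma mxcvgS m n (M_ : nat -> 'M[C]_(m, n)) M :
  mxcvg M_ M -> mxcvg (fun k => M_ k.+1) M.
Proof. by move=> cM i j; apply: (ccvgS (cM i j)). Qed.

Lemma mxcvgN m n (M_ : nat -> 'M[C]_(m, n)) M :
  mxcvg M_ M -> mxcvg (fun k => - M_ k) (- M).
Proof.
by move=> cM i j; rewrite mxE; apply: ccvg_ext (ccvgN (cM i j)) => k; rewrite mxE.
Qed.

Lemma mxcvgD m n (M_ N_ : nat -> 'M[C]_(m, n)) M N :
  mxcvg M_ M -> mxcvg N_ N -> mxcvg (fun k => M_ k + N_ k) (M + N).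
Proof.
move=> cM cN i j; rewrite mxE; apply: ccvg_ext (ccvgD (cM i j) (cN i j)) => k.
by rewrite mxE.
Qed.

Lemma mxcvgB m n (M_ N_ : nat -> 'M[C]_(m, n)) M N :
  mxcvg M_ M -> mxcvg N_ N -> mxcvg (fun k => M_ k - N_ k) (M - N).
Proof. by move=> cM /mxcvgN; apply: mxcvgD. Qed.

Lemma mxcvgM m n p (M_ : nat -> 'M[C]_(m, n)) (N_ : nat -> 'M[C]_(n, p)) M N :
  mxcvg M_ M -> mxcvg N_ N -> mxcvg (fun k => M_ k *m N_ k) (M *m N).
Proof.
move=> cM cN i j; rewrite mxE.
have := ccvg_sum (index_enum 'I_n) (fun r => ccvgM (cM i r) (cN r j)).
by apply: ccvg_ext => k; rewrite mxE.
Qed.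

Lemma mxcvg_conj m n (M_ : nat -> 'M[C]_(m, n)) M :
  mxcvg M_ M -> mxcvg (fun k => cmx (M_ k)) (cmx M).
Proof.
by move=> cM i j; rewrite mxE; apply: ccvg_ext (ccvg_conj (cM i j)) => k; rewrite mxE.
Qed.

Lemma mxcvg_adj m n (M_ : nat -> 'M[C]_(m, n)) M :
  mxcvg M_ M -> mxcvg (fun k => (M_ k) ^t*) (M ^t*).
Proof.
move=> cM; apply: mxcvg_conj => i j; rewrite mxE.
by apply: ccvg_ext (cM j i) => k; rewrite mxE.
Qed.

Lemma psd_lim n (M_ : nat -> 'M[C]_n) M :
  (forall k, psdmx (M_ k)) -> mxcvg M_ M -> psdmx M.
Proof.
move=> pM cM; split.
  apply/hermP; apply: mxcvg_unique (mxcvg_adj cM) _.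
  by apply: mxcvg_ext cM => k; have [/hermP ->] := pM k.
move=> x; apply: (@ccvg_ge0 _ (fun k => quadform (M_ k) x)).
  by move=> k; have [_] := pM k.
exact: (mxcvgM (mxcvgM (mxcvg_cst _) cM) (mxcvg_cst _)).
Qed.

Lemma loewner_nonincreasing_cvg n (M_ : nat -> 'M[C]_n) (B : 'M[C]_n) :
  (forall k, loewner_le (M_ k.+1) (M_ k)) -> (forall k, loewner_le B (M_ k)) ->
  exists M, mxcvg M_ M.
Proof.
move=> dM bM.
have cq x : exists l, ccvg (fun k => quadform (M_ k) x) l.
  apply: (@ccvg_nonincreasing _ _ (quadform B x)) => k.
    by have [_ /(_ x)] := dM k; rewrite quadformD quadformN subr_ge0.
  by have [_ /(_ x)] := bM k; rewrite quadformD quadformN subr_ge0.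
have ce (ij : 'I_n * 'I_n) : exists l, ccvg (fun k => M_ k ij.1 ij.2) l.
  case: ij => i j; set x : 'cV[C]_n := delta_mx i 0; set y : 'cV[C]_n := delta_mx j 0.
  have [a ha] := cq (x + y); have [b hb] := cq (x + 'i *: y).
  have [c hc] := cq x; have [d hd] := cq y.
  exists (2^-1 * (a - 'i * b - (1 - 'i) * (c + d))) => /=.
  have := ccvgZ 2^-1 (ccvgD (ccvgD ha (ccvgN (ccvgZ 'i hb)))
    (ccvgN (ccvgZ (1 - 'i) (ccvgD hc hd)))).
  apply: ccvg_ext => k; rewrite -(polarization (M_ k)).
  by rewrite trmx_delta map_delta_mx -rowE -colE !mxE.
have [l hl] := choice ce.
by exists (\matrix_(i, j) l (i, j)) => i j; rewrite mxE; apply: (hl (i, j)).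
Qed.

End MatrixLimits.

(** * The fixed-point iteration *)

Section FixedPoint.
Variables (R : realType) (n : nat).
Local Notation C := R[i].
Implicit Types (A X Y L : 'M[C]_n).

Definition eqmap A X := 1%:M - A ^t* *m invmx (cmx X) *m A.

Definition subsolution A L := pdmx L /\ loewner_le L (eqmap A L).

Definition iterate A k := iter k (eqmap A) 1%:M.

Lemma pd_solutionE A X : pd_solution A X <-> pdmx X /\ X = eqmap A X.
Proof.
by split=> -[pX eX]; split=> //; [rewrite /eqmap -eX addrK|rewrite {1}eX subrK].
Qed.

Lemma solution_sub A X : pd_solution A X -> subsolution A X.
Proof. by move=> /pd_solutionE[pX eX]; split=> //; rewrite -eX; apply: loewner_refl. Qed.

Lemma eqmap_mono A X Y :
  pdmx X -> loewner_le X Y -> loewner_le (eqmap A X) (eqmap A Y).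
Proof.
move=> pX leXY.
have := loewner_congr A (loewner_inv (pd_conj pX) (loewner_conj leXY)).
congr psdmx; rewrite /eqmap.
move: (A ^t* *m _ *m A) (A ^t* *m invmx (cmx X) *m A) => P Q.
by apply/matrixP => i j; rewrite !mxE; ring.
Qed.

Lemma eqmap_le1 A X : pdmx X -> loewner_le (eqmap A X) 1%:M.
Proof.
move=> pX; have := psd_congr A (pd_psd (pd_inv (pd_conj pX))).
by congr psdmx; rewrite /eqmap subKr.
Qed.

Lemma subsolution_le_iterate A L k :
  subsolution A L -> loewner_le L (iterate A k).
Proof.
case=> pL leL; elim: k => [|k IHk] /=.
  exact: loewner_trans leL (eqmap_le1 A pL).
exact: loewner_trans leL (eqmap_mono A pL IHk).
Qed.

Lemma iterate_noninc A L k :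
  subsolution A L -> loewner_le (iterate A k.+1) (iterate A k).
Proof.
move=> sL; have pI j : pdmx (iterate A j).
  by apply: loewner_pd (subsolution_le_iterate j sL); case: sL.
by elim: k => [|k IHk] /=; [apply/eqmap_le1/(pI 0)|apply: eqmap_mono (pI k.+1) _].
Qed.

(** The inverses of the conjugates of the iterates increase below the inverse of
    the conjugate of [L], so they converge as well; their limit is the inverse
    of the conjugate of [X] because a product of limits is the limit of the
    products.  This replaces continuity of inversion. *)
Lemma iterate_cvg A L : subsolution A L ->
  exists X, [/\ mxcvg (iterate A) X, pd_solution A X &
    forall L', subsolution A L' -> loewner_le L' X].
Proof.
move=> sL; have pL := sL.1.
have leI j : loewner_le L (iterate A j) by apply: subsolution_le_iterate.
have pI j : pdmx (iterate A j) by apply: loewner_pd (leI j).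
have [X cX] : exists X, mxcvg (iterate A) X.
  apply: (@loewner_nonincreasing_cvg _ _ (iterate A) L _ leI) => k.
  exact: (iterate_noninc k sL).
have [Z cZ] : exists Z, mxcvg (fun k => - invmx (cmx (iterate A k))) Z.
  apply: (loewner_nonincreasing_cvg (B := - invmx (cmx L))) => k;
    rewrite /loewner_le opprK addrC; apply: loewner_inv.
  - exact: pd_conj (pI k.+1).
  - exact/loewner_conj/(iterate_noninc k sL).
  - exact: pd_conj pL.
  - exact: loewner_conj (leI k).
have upper L' : subsolution A L' -> loewner_le L' X.
  move=> sL'; apply: psd_lim (mxcvgB cX (mxcvg_cst _)) => k.
  exact: subsolution_le_iterate.
have pX : pdmx X by apply: loewner_pd pL (upper L sL).
have ZE : - Z = invmx (cmx X).
  have uX := pd_unit (pd_conj pX).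
  have : - Z *m cmx X = 1%:M.
    have := mxcvgM (mxcvgN cZ) (mxcvg_conj cX).
    move/mxcvg_unique; apply; apply: mxcvg_ext (mxcvg_cst _) => k.
    by rewrite opprK mulVmx // (pd_unit (pd_conj (pI k))).
  by move=> e; rewrite -[LHS](mulmxK uX) e mul1mx.
exists X; split=> //; apply/pd_solutionE; split=> //.
apply: mxcvg_unique (mxcvgS cX) _; rewrite /eqmap -ZE.
apply: mxcvg_ext (mxcvgB (mxcvg_cst _) (mxcvgM (mxcvgM (mxcvg_cst _) (mxcvgN cZ)) (mxcvg_cst _))) => k.
by rewrite opprK.
Qed.

(** The defect is half the hypothesis: [F (1/2) - 1/2 = 1/2 (1 - 4 A^* A)]. *)
Lemma half_subsolution A :
  psdmx (1%:M - 4 *: (A ^t* *m A)) -> subsolution A (2^-1)%:M.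
Proof.
move=> pA.
have p2 : pdmx ((2^-1)%:M : 'M[C]_n).
  by rewrite -scalemx1; apply: pdZ; [rewrite invr_gt0|apply: pd1].
split; first exact: p2.
have h0 : 0 <= 2^-1 :> C by rewrite invr_ge0.
have := psdZ h0 pA; congr psdmx.
rewrite /eqmap map_scalar_mx /= fmorphV rmorph_nat invmx_scalar invrK.
rewrite mul_mx_scalar -scalemxAl.
move: (A ^t* *m A) => P; apply/matrixP => i j; rewrite !mxE.
by case: (i == j); rewrite ?mulr1n ?mulr0n; field.
Qed.

End FixedPoint.

(** * Con-normal coefficients *)

Section ConNormal.
Variables (R : realType) (n : nat).
Local Notation C := R[i].
Implicit Types (A X Y L : 'M[C]_n).

(** Con-normality says [A A^* = conj (A^* A)].  Both sides reduce to
    [A - conj (A^* ) X^-1 (conj A) A], the inverse of [X] being moved past [A]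
    by the conjugate of the hypothesis. *)
Lemma connormal_eqmap A X : connormalmx A -> X \in unitmx ->
  A *m X = cmx X *m A -> A *m eqmap A X = cmx (eqmap A X) *m A.
Proof.
move=> nA uX AX; have uX' : cmx X \in unitmx by rewrite map_unitmx.
have AXi : A *m invmx X = invmx (cmx X) *m A.
  by apply: (canLR (mulmxK uX)); rewrite -mulmxA AX mulKmx.
have XiA : cmx A *m invmx (cmx X) = invmx X *m cmx A.
  by have := congr1 cmx AXi; rewrite !mxconjM !mxconjV map_mxCK.
have AA : A *m A ^t* = A^T *m cmx A.
  by have := congr1 cmx nA; rewrite mxconjM !map_mxCK => <-.
rewrite /eqmap mxconjB mxconj1 mulmxBr mulmxBl mulmx1 mul1mx; congr (_ - _).
rewrite !mxconjM mxconjV !map_mxCK.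
move: (invmx X) (invmx (cmx X)) XiA => Xi B XiA.
by rewrite !mulmxA AA -(mulmxA A^T) XiA !mulmxA.
Qed.

(** From [A X = (conj X) A] one gets [(conj X)^-1 A = A X^-1]; multiplying the
    equation by [X] on the right leaves the quadratic [X^2 + A^* A = X]. *)
Lemma connormal_solution A L : connormalmx A -> subsolution A L ->
  exists X, [/\ pd_solution A X,
    (forall L', subsolution A L' -> loewner_le L' X) &
    (2 *: X - 1%:M) *m (2 *: X - 1%:M) = 1%:M - 4 *: (A ^t* *m A)].
Proof.
move=> nA sL; have [X [cX sX mX]] := iterate_cvg sL.
exists X; split=> //.
have pI j : pdmx (iterate A j).
  exact: loewner_pd sL.1 (subsolution_le_iterate j sL).
have AI k : A *m iterate A k = cmx (iterate A k) *m A.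
  elim: k => [|k IHk] /=; first by rewrite mxconj1 mulmx1 mul1mx.
  by apply: connormal_eqmap => //; apply: pd_unit.
have AX : A *m X = cmx X *m A.
  apply: mxcvg_unique (mxcvgM (mxcvg_cst A) cX) _.
  by apply: mxcvg_ext (mxcvgM (mxcvg_conj cX) (mxcvg_cst A)) => k; rewrite AI.
have [pX eX] := sX; have uX := pd_unit pX.
have XX : X *m X + A ^t* *m A = X.
  have := congr1 (mulmx^~ X) eX.
  rewrite mulmxDl mul1mx -!mulmxA AX mulKmx // map_unitmx //.
have -> : A ^t* *m A = X - X *m X.
  by apply/eqP; rewrite eq_sym subr_eq addrC XX.
rewrite mulmxBr !mulmxBl !mulmx1 mul1mx -!scalemxAl -!scalemxAr.
by move: (X *m X) => X2; apply/matrixP => i j; rewrite !mxE; ring.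
Qed.

Lemma connormal_maximal A :
  connormalmx A -> psdmx (1%:M - 4 *: (A ^t* *m A)) ->
  maximal_pd_solution A
    ((1 / 2) *: (1%:M + psd_sqrtmx (1%:M - 4 *: (A ^t* *m A)))).
Proof.
move=> nA pA; have sA := half_subsolution pA.
have [X [sX mX sqX]] := connormal_solution nA sA.
(* The subsolution 1/2 lies below X, which doubles to 0 <= 2 X - 1. *)
have pS : psdmx (2 *: X - 1%:M).
  have := psdZ (ler0n _ 2) (mX _ sA); congr psdmx.
  by rewrite scalerBr scale_scalar_mx mulfV // pnatr_eq0.
rewrite (psd_sqrtmxE pS sqX) [_ *: _](_ : _ = X); last first.
  by apply/matrixP => i j; rewrite !mxE; field.
split; first exact: sX.
by move=> Y /solution_sub; apply: mX.
Qed.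

Lemma connormal_trmx A : connormalmx A -> connormalmx A^T.
Proof. by rewrite /connormalmx !mxconjM trmxK !map_mxCK. Qed.

Lemma connormal_gram_trmx A :
  connormalmx A -> (A^T) ^t* *m A^T = A ^t* *m A.
Proof. by move=> ->; rewrite mxconjM trmxK map_mxCK. Qed.

(** For invertible [A] the equation says [1 - Y = A^* (conj Y)^-1 A], which is
    positive definite and can be inverted explicitly.  Substituting this inverse
    in the equation for [A^T] leaves [(1 - Y) + Y = 1]. *)
Lemma solution_trmx A Y : A \in unitmx ->
  pd_solution A Y -> pd_solution A^T (1%:M - Y).
Proof.
move=> uA [pY eY]; have uY := pd_unit pY.
have uA' : cmx A \in unitmx by rewrite map_unitmx.
have uT : A^T \in unitmx by rewrite unitmx_tr.
have WE : 1%:M - Y = A ^t* *m invmx (cmx Y) *m A by rewrite -eY addrAC subrr add0r.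
have pW : pdmx (1%:M - Y).
  by rewrite WE; apply: pd_congr uA (pd_inv (pd_conj pY)).
split; first exact: pW.
have WcE : cmx (1%:M - Y) = A^T *m invmx Y *m cmx A.
  by rewrite WE !mxconjM mxconjV !map_mxCK.
have -> : invmx (cmx (1%:M - Y)) = invmx (cmx A) *m Y *m invmx A^T.
  rewrite -[RHS](mulmxK (pd_unit (pd_conj pW))) {2}WcE !mulmxA.
  by rewrite (mulmxKV uT) (mulmxK uY) (mulVmx uA') mul1mx.
by rewrite trmxK !mulmxA (mulmxV uA') mul1mx (mulmxKV uT) subrK.
Qed.

End ConNormal.

Local Open Scope complex_scope.

Theorem theorem6 (R : realType) (n : nat) (A : 'M[R[i]]_n) :
  (spectral_norm A <= 1 / 2 ->
     exists X : 'M[R[i]]_n, pd_solution A X) /\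
  (connormalmx A ->
     ((exists X : 'M[R[i]]_n, pd_solution A X) <-> spectral_norm A <= 1 / 2) /\
     (spectral_norm A <= 1 / 2 ->
        maximal_pd_solution A
          ((1 / 2) *: (1%:M + psd_sqrtmx (1%:M - 4 *: (A ^t* *m A)))) /\
        (A \in unitmx ->
           minimal_pd_solution A
             ((1 / 2) *: (1%:M - psd_sqrtmx (1%:M - 4 *: (A ^t* *m A))))))).
Proof.
have exA : spectral_norm A <= 1 / 2 -> exists X, pd_solution A X.
  move=> /spectral_norm_le_half/half_subsolution/iterate_cvg[X [_ sX _]].
  by exists X.
split=> // nA; split.
  split=> // -[X /solution_sub/(connormal_solution nA)[Y [[pY _] _ sqY]]].
  (* The square of a hermitian matrix is its Gram matrix. *)
  apply/spectral_norm_le_half; rewrite -sqY -{1}[_ - _](_ : (2 *: Y - 1%:M) ^t* = _).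
    exact: psd_gram.
  have [/hermP hY _] := pY.
  by rewrite adjmxB adjmx1 adjmxZ hY conj_Creal ?realn.
move=> /spectral_norm_le_half pA; split=> [|uA]; first exact: connormal_maximal.
have gT := connormal_gram_trmx nA.
have := connormal_maximal (connormal_trmx nA); rewrite gT => /(_ pA).
set S := psd_sqrtmx _; set X := _ *: _; move=> [sX mX].
rewrite [_ *: (1%:M - S)](_ : _ = 1%:M - X); last first.
  by rewrite /X; apply/matrixP => i j; rewrite !mxE; field.
split; first by rewrite -[A]trmxK; apply: solution_trmx; rewrite ?unitmx_tr.
move=> Y /(solution_trmx uA)/mX; congr psdmx.
by rewrite !opprB addrCA.
Qed.
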